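(* $Q_{A(\mathbb{Z}[i],4)} \ge Q_{U(\mathbb{Z}[i],\emptyset,4)} \ge \frac{10}{3}$.
   Context: $R=\mathbb{Z}[i]=\{a+bi : a,b\in\mathbb{Z}\}$, with norm $N(a+bi)=a^2+b^2$. For a positive integer $m$, $\mathrm{rad}(m)$ is the largest square-free positive divisor of $m$. For $a=(a_1,\dots,a_n)\in R^n$ with all $a_j\neq 0$, the quality is $$q(a)=\frac{\log(\max(N(a_1),\dots,N(a_n)))}{\log(\mathrm{rad}(N(a_1\cdots a_n)))}.$$ For an infinite (countable) set $S=\{a^{(1)},a^{(2)},\dots\}$ of such $n$-tuples (enumerated without repetition), $Q_S=\limsup_{k\to\infty}q(a^{(k)})$ (possibly $+\infty$). The finitely many tuples consisting only of units, for which the denominator is $0$, are disregarded in the limsup. $A(R,n)$ is the set of $a=(a_1,\dots,a_n)\in R^n$ with all $a_j\ne 0$ satisfying: (Z) $a_1+\dots+a_n=0$; (S1) there are no $b_1,\dots,b_n\in\{0,1\}$ and indices $i,j$ with $b_i=0$, $b_j=1$ and $\sum_{k=1}^n b_ka_k=0$; (G1) the greatest common divisor of $a_1,\dots,a_n$ in $R$ is $1$ (up to units). $U(R,\emptyset,n)$ is the set of $a=(a_1,\dots,a_n)\in R^n$ with all $a_j\neq 0$ satisfying: (Z) $a_1+\dots+a_n=0$; (S2) there are no $b_1,\dots,b_n\in\{-1,0,1\}$ and indices $i,j$ with $b_i=0$, $b_j=1$ and $\sum_{k=1}^n b_ka_k=0$; (G2) for all $i<j$, the greatest common divisor of $a_i$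 and $a_j$ in $R$ is $1$ (up to units). *)

(* Defs.v *)
From HB Require Import structures.
From mathcomp Require Import all_boot all_order all_algebra.
From mathcomp Require Import ring lra zify.
From mathcomp Require Import all_classical all_reals all_analysis.

Set Implicit Arguments.
Unset Strict Implicit.
Unset Printing Implicit Defensive.

Import Order.TTheory GRing.Theory Num.Theory.

Local Open Scope ring_scope.

Record gint : Type := GInt { gre : int; gim : int }.

Definition gint_pair (z : gint) : int * int := (gre z, gim z).
Definition pair_gint (p : int * int) : gint := GInt p.1 p.2.

Lemma gint_pairK : cancel gint_pair pair_gint.
Proof. by case. Qed.

HB.instance Definition _ := Countable.copy gint (can_type gint_pairK).

Definition gadd (x y : gint) := GInt (gre x + gre y) (gim x + gim y).
Definition gopp (x : gint) := GInt (- gre x) (- gim x).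
Definition gmul (x y : gint) :=
  GInt (gre x * gre y - gim x * gim y) (gre x * gim y + gim x * gre y).

Fact gaddA : associative gadd.
Proof. by case=> a b [c d] [e f]; congr GInt => /=; ring. Qed.
Fact gaddC : commutative gadd.
Proof. by case=> a b [c d]; congr GInt => /=; ring. Qed.
Fact gadd0 : left_id (GInt 0 0) gadd.
Proof. by case=> a b; congr GInt => /=; ring. Qed.
Fact gaddN : left_inverse (GInt 0 0) gopp gadd.
Proof. by case=> a b; congr GInt => /=; ring. Qed.

HB.instance Definition _ := GRing.isZmodule.Build gint gaddA gaddC gadd0 gaddN.

Fact gmulA : associative gmul.
Proof. by case=> a b [c d] [e f]; congr GInt => /=; ring. Qed.
Fact gmulC : commutative gmul.
Proof. by case=> a b [c d]; congr GInt => /=; ring. Qed.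
Fact gmul1 : left_id (GInt 1 0) gmul.
Proof. by case=> a b; congr GInt => /=; ring. Qed.
Fact gmulDl : left_distributive gmul gadd.
Proof. by case=> a b [c d] [e f]; congr GInt => /=; ring. Qed.
Fact g1_neq0 : GInt 1 0 != GInt 0 0.
Proof. by []. Qed.

HB.instance Definition _ :=
  GRing.Zmodule_isComNzRing.Build gint gmulA gmulC gmul1 gmulDl g1_neq0.

Definition gaussnorm (z : gint) : nat := (`|gre z| ^ 2 + `|gim z| ^ 2)%N.

Lemma gaussnormE (z : gint) : (gaussnorm z)%:Z = gre z ^+ 2 + gim z ^+ 2.
Proof. by rewrite /gaussnorm PoszD -!abszX !abszE !ger0_norm ?sqr_ge0. Qed.

Lemma gaussnormM (x y : gint) :
  gaussnorm (x * y) = (gaussnorm x * gaussnorm y)%N.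
Proof.
apply/eqP; rewrite -eqz_nat PoszM !gaussnormE; apply/eqP.
by case: x y => a b [c d] /=; ring.
Qed.

(* The units of Z[i] are the elements of norm 1, and z^-1 is then the
   conjugate of z; the instance below certifies this. *)
Definition gunit : {pred gint} := fun z => gaussnorm z == 1%N.
Definition ginv (z : gint) : gint :=
  if gaussnorm z == 1%N then GInt (gre z) (- gim z) else z.

Fact gmulVx : {in gunit, left_inverse 1 ginv *%R}.
Proof.
move=> z; rewrite unfold_in /ginv => Nz; rewrite Nz.
have: (gaussnorm z)%:Z = 1 by rewrite (eqP Nz).
rewrite gaussnormE; case: z {Nz} => a b /= Nz.
by congr GInt => /=; rewrite -?Nz; ring.
Qed.

Fact gunitPl (x y : gint) : y * x = 1 -> gunit x.
Proof.
move=> yx; have := gaussnormM y x; rewrite yx => /esym/eqP.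
by rewrite muln_eq1 => /andP[].
Qed.

Fact ginv_out : {in [predC gunit], ginv =1 id}.
Proof. by move=> z; rewrite inE unfold_in /ginv => /negbTE ->. Qed.

HB.instance Definition _ :=
  GRing.ComNzRing_hasMulInverse.Build gint gmulVx gunitPl ginv_out.

Definition gdvd (d x : gint) : Prop := exists c : gint, x = c * d.

(* A greatest common divisor is determined only up to a unit. *)
Definition is_gcd (I : Type) (a : I -> gint) (d : gint) : Prop :=
  (forall i, gdvd d (a i)) /\
  (forall c, (forall i, gdvd c (a i)) -> gdvd c d).

(* On positive arguments; a [d] with [d ^ 2 %| m] is itself a divisor of [m]. *)
Definition squarefree (m : nat) : bool :=
  all (fun d => (d ^ 2 %| m) ==> (d == 1))%N (divisors m).

Definition radn (m : nat) : nat := (\max_(d <- divisors m | squarefree d) d)%N.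

Definition quality (R : realType) (n : nat) (a : {ffun 'I_n -> gint}) : R :=
  ln (\max_(j < n) gaussnorm (a j))%N%:R /
  ln (radn (gaussnorm (\prod_(j < n) a j)))%:R.

Local Open Scope classical_set_scope.

Definition all_units (n : nat) : set {ffun 'I_n -> gint} :=
  [set a : {ffun 'I_n -> gint} | forall j, a j \is a GRing.unit].
Arguments all_units n : clear implicits.

(* [e] lists, without repetition, the elements of [S] that have a quality,
   i.e. those that do not consist of units only. *)
Definition enumerates (n : nat) (S : set {ffun 'I_n -> gint})
    (e : nat -> {ffun 'I_n -> gint}) : Prop :=
  set_bij [set: nat] (S `\` all_units n) e.

Definition limsup_quality (R : realType) (n : nat)
    (e : nat -> {ffun 'I_n -> gint}) : \bar R :=
  limn_esup (fun k => (quality R (e k))%:E).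

Definition condZ (n : nat) (a : {ffun 'I_n -> gint}) : Prop :=
  \sum_(k < n) a k = 0.

Definition no_subsum (B : seq int) (n : nat) (a : {ffun 'I_n -> gint}) : Prop :=
  ~ exists b : 'I_n -> int,
      [/\ forall k, b k \in B,
          exists i j, b i = 0 /\ b j = 1
        & \sum_(k < n) a k *~ b k = 0].

Definition condS1 (n : nat) (a : {ffun 'I_n -> gint}) : Prop :=
  no_subsum [:: 0; 1] a.

Definition condS2 (n : nat) (a : {ffun 'I_n -> gint}) : Prop :=
  no_subsum [:: -1; 0; 1] a.

Definition condG1 (n : nat) (a : {ffun 'I_n -> gint}) : Prop := is_gcd a 1.

Definition condG2 (n : nat) (a : {ffun 'I_n -> gint}) : Prop :=
  forall i j : 'I_n, (i < j)%N ->
    is_gcd (fun t : bool => if t then a i else a j) 1.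

Definition A_set (n : nat) : set {ffun 'I_n -> gint} :=
  [set a : {ffun 'I_n -> gint} |
    [/\ forall j, a j != 0, condZ a, condS1 a & condG1 a]].

(* U(Z[i], emptyset, n) *)
Definition U_set (n : nat) : set {ffun 'I_n -> gint} :=
  [set a : {ffun 'I_n -> gint} |
    [/\ forall j, a j != 0, condZ a, condS2 a & condG2 a]].

Arguments A_set n : clear implicits.
Arguments U_set n : clear implicits.

(* Main.v *)
(* If a is even and b ^ 2 = 3 a ^ 2 - 2 a + 1, then with u = a + b i
     1 + (2 a - 1) ^ 5 = u ^ 5 + (conj u) ^ 5
   is a sum of four pairwise coprime odd terms.  Writing w = 2 a - 1, the largest
   norm is at least w ^ 10, whereas N(u) = w ^ 2 + w + 1 is shared by u and
   conj u and w is rational, so that the radical divides w (w ^ 2 + w + 1).  Hence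
   the quality is at least 10 ln w / (3 ln w + O(1)), and the Pell-type equation
   for (a, b) has infinitely many solutions with a even, starting at (2, 3).
   The subsum condition holds because the imaginary part of u ^ 5 is nonzero:
   it forces equal coefficients on u ^ 5 and (conj u) ^ 5, and then
   |w ^ 5| > 2 forces the other two to agree with them. *)

Require Import Defs.
From mathcomp Require Import all_boot all_order all_algebra.
From mathcomp Require Import ring lra zify.
From mathcomp Require Import all_classical all_reals all_analysis.
Import Order.TTheory GRing.Theory Num.Theory.
Import numFieldNormedType.Exports.
Local Open Scope ring_scope.

(** * Radicals of powers *)

Lemma squarefree_dvdn_exp (d x k : nat) :
  (0 < d)%N -> squarefree d -> (d %| x ^ k)%N -> (d %| x)%N.
Proof.
move=> d0 /allP sqf dxk; set g := gcdn d x.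
have /dvdnP[e de] : (g %| d)%N by exact: dvdn_gcdl.
have e0 : (0 < e)%N by move: d0; rewrite de muln_gt0 => /andP[].
have [e1|e1] := leqP e 1.
  have -> : d = g by rewrite {1}de (_ : e = 1%N) ?mul1n//; lia.
  exact: dvdn_gcdr.
(* A prime [p] of the cofactor [e] also divides [x], hence the gcd [g], so its square divides
   [d = e * g]. *)
set p := pdiv e; have pp : prime p by exact: pdiv_prime.
have pe : (p %| e)%N by exact: pdiv_dvd.
have pd : (p %| d)%N by rewrite de dvdn_mulr.
have px : (p %| x)%N.
  by have := dvdn_trans pd dxk; rewrite Euclid_dvdX// => /andP[].
have pg : (p %| g)%N by rewrite dvdn_gcd pd.
have p2 : (p ^ 2 %| d)%N by rewrite de mulnC expnS expn1 mulnC dvdn_mul.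
have := sqf p; rewrite -dvdn_divisors// pd p2 => /(_ isT) /eqP p1.
by move: pp; rewrite p1.
Qed.

Lemma radn_exp_le (x k : nat) : (0 < x)%N -> (radn (x ^ k) <= x)%N.
Proof.
move=> x0; apply/bigmax_leqP_seq => d; rewrite -dvdn_divisors ?expn_gt0 ?x0//.
move=> dxk sqf; apply: dvdn_leq => //.
apply: (@squarefree_dvdn_exp _ _ k) => //.
by apply: dvdn_gt0 dxk; rewrite expn_gt0 x0.
Qed.

(** Keeps the denominator of the quality positive: a prime divisor is squarefree. *)
Lemma radn_gt1 (m : nat) : (1 < m)%N -> (1 < radn m)%N.
Proof.
move=> m1; have pp := pdiv_prime m1.
apply: leq_trans (prime_gt1 pp) _.
apply: (@leq_bigmax_seq _ _ squarefree id).
  by rewrite -dvdn_divisors ?pdiv_dvd// ltnW.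
apply/allP => d; rewrite -dvdn_divisors ?prime_gt0// => dp.
case/primeP: (pp) => _ /(_ _ dp) /orP[/eqP->|/eqP->]; first by rewrite implybT.
rewrite gtnNdvd ?prime_gt0//.
by rewrite expnS expn1 ltn_Pmulr ?prime_gt1 ?prime_gt0.
Qed.

(** * Coprimality through Bezout relations *)

Lemma is_gcd1_bezout (I : Type) (a : I -> gint) (i j : I) (r s : gint) :
  r * a i + s * a j = 1 -> is_gcd a 1.
Proof.
move=> rs; split=> [k|c ca]; first by exists (a k); rewrite mulr1.
have [[x ax] [y ay]] := (ca i, ca j).
by exists (r * x + s * y); rewrite -rs ax ay; ring.
Qed.

Definition bezout {R : comNzRingType} (x y : R) :=
  exists r s : R, r * x + s * y = 1.

Lemma bezoutX (R : comNzRingType) (x y : R) (k l : nat) :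
  bezout x y -> bezout (x ^+ k) (y ^+ l).
Proof.
have bezoutC (a b : R) : bezout a b -> bezout b a.
  by case=> r [s rs]; exists s, r; rewrite addrC.
have bezoutXr (a b : R) m : bezout a b -> bezout a (b ^+ m).
  case=> r [s rs]; elim: m => [|m [r' [s' rs']]].
    by exists 0, 1; rewrite expr0; ring.
  (* Insert [r' * a + s' * b ^+ m = 1] as a factor of [s * b] in [r * a + s * b = 1]. *)
  exists (r + s * b * r'), (s * s'); rewrite exprS.
  rewrite -[RHS]rs -[X in _ = _ + X]mulr1 -rs'; ring.
by move=> xy; apply/bezoutXr/bezoutC/bezoutXr/bezoutC.
Qed.

(** * The quadruple: zero sum and subsums *)

(** Even powers of [y] are kept as powers of [y ^+ 2], so that [pell] can be substituted. *)
Lemma gintX5 (x y : int) : GInt x y ^+ 5 =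
  GInt (x ^+ 5 - 10 * x ^+ 3 * y ^+ 2 + 5 * x * (y ^+ 2) ^+ 2)
       (y * (5 * x ^+ 4 - 10 * x ^+ 2 * y ^+ 2 + (y ^+ 2) ^+ 2)).
Proof. by rewrite !exprS expr0 mulr1; congr GInt => /=; ring. Qed.

Lemma gint_mulrz (x y n : int) : GInt x y *~ n = GInt (x * n) (y * n).
Proof.
have mulrn m : GInt x y *+ m = GInt (x * m%:Z) (y * m%:Z).
  elim: m => [|m IH]; first by rewrite mulr0n !mulr0.
  by rewrite mulrS IH; congr GInt => /=; lia.
case: n => m; first exact: mulrn.
rewrite NegzE mulrNz -pmulrn mulrn; congr GInt => /=; lia.
Qed.

(* The four terms for a = 2 c; u and conj u are negated to make the sum zero. *)
Definition quad (c b : int) : {ffun 'I_4 -> gint} :=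
  [ffun j => nth 0 [:: 1; GInt (4 * c - 1) 0 ^+ 5;
     GInt (- (2 * c)) b ^+ 5; GInt (- (2 * c)) (- b) ^+ 5] (val j)].

(* b ^ 2 = 3 a ^ 2 - 2 a + 1 for a = 2 c. *)
Definition pell (c b : int) : Prop := b ^+ 2 = 12 * c ^+ 2 - 4 * c + 1.

Lemma quad_condZ (c b : int) : pell c b -> condZ (quad c b).
Proof.
rewrite /pell => cb; rewrite /condZ !big_ord_recl big_ord0 !ffunE /= !gintX5 addr0.
rewrite (_ : 0 = GInt 0 0)//.
by congr GInt => /=; rewrite (sqrrN b) cb; ring.
Qed.

Lemma quad_im_neq0 (c b : int) : pell c b -> b != 0 ->
  gim (GInt (- (2 * c)) b ^+ 5) != 0.
Proof.
rewrite /pell => cb b0; rewrite gintX5 /=.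
(* As b ^ 2 = 2 M + 1, the cofactor of b is odd. *)
set M := 6 * c ^+ 2 - 2 * c.
rewrite cb (_ : _ + _ =
  2 * (2 * M ^+ 2 + 2 * M - 20 * c ^+ 2 * (2 * M + 1) + 40 * c ^+ 4) + 1).
  by rewrite mulf_neq0//; lia.
by rewrite /M; ring.
Qed.

Lemma add_mul_eq0_small (x y w : int) :
  `|x| <= 2 -> 3 <= w -> x + y * w = 0 -> y = 0.
Proof. nia. Qed.

Lemma quad_condS2 (c b : int) : pell c b -> 1 <= c -> b != 0 -> condS2 (quad c b).
Proof.
move=> cb c1 b0 [t [tB [i [j [ti tj]]]]].
rewrite !big_ord_recl big_ord0 !ffunE /= addr0.
set t0 := t _; set t1 := t _; set t2 := t _; set t3 := t _ => st.
have [P uP] : exists P, GInt (- (2 * c)) b ^+ 5 =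
    GInt P (gim (GInt (- (2 * c)) b ^+ 5)).
  by exists (gre (GInt (- (2 * c)) b ^+ 5)); case: (_ ^+ 5).
have := quad_im_neq0 c b cb b0; move: uP; set Q := gim _ => uP Q0.
have vP : GInt (- (2 * c)) (- b) ^+ 5 = GInt P (- Q).
  move: uP; rewrite !gintX5 => -[PE QE]; rewrite -PE -QE.
  by congr GInt; ring.
have wP : GInt (4 * c - 1) 0 ^+ 5 = GInt ((4 * c - 1) ^+ 5) 0.
  by rewrite gintX5; congr GInt; ring.
have := quad_condZ c b cb.
rewrite /condZ !big_ord_recl big_ord0 !ffunE /= addr0 uP vP wP => -[sP _].
move: st; rewrite uP vP wP (_ : 1 = GInt 1 0)// !gint_mulrz => -[sr si].
(* The imaginary part of the subsum is [Q * (t2 - t3)]. *)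
have t23 : t2 = t3 by apply: (mulfI Q0); lia.
set W := (4 * c - 1) ^+ 5 in wP sP sr.
have W3 : 3 <= W by apply: le_trans (ler_eXnr _ _) => //; lia.
have tr k : -1 <= t k <= 1 by have := tB k; rewrite !inE; lia.
(* Subtracting [t2] times the full relation [1 + W + 2 P = 0] eliminates [P]. *)
have t02 : (t0 - t2) + (t1 - t2) * W = 0.
  by have := congr1 (fun z => z * t2) sP; rewrite -t23 in sr; lia.
have t12 : t1 = t2.
  apply/eqP; rewrite -subr_eq0; apply/eqP.
  have t02_le : `|t0 - t2| <= 2.
    have /andP[] := tr ord0; have /andP[] := tr (lift ord0 (lift ord0 ord0)).
    rewrite -/t0 -/t2; lia.
  exact: add_mul_eq0_small t02_le W3 t02.
have t01 : t0 = t2 by lia.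
have tE k : t k = t2.
  case: k => -[|[|[|[|//]]]] k4; [rewrite -t01|rewrite -t12| |rewrite t23];
  by congr (t _); apply: val_inj.
by move: ti tj; rewrite !tE => ->.
Qed.

(** * Limit superior under injective reindexing *)

Local Open Scope classical_set_scope.

(** Each value is taken at most once, so by induction on [N] the values below [N] are eventually
    avoided. *)
Lemma inj_cvg_infty (s : nat -> nat) : injective s -> s @ \oo --> \oo.
Proof.
move=> s_inj; suff s_ge N : \forall n \near \oo, (N <= s n)%N.
  move=> V [N _ NV]; have := s_ge N; apply: filterS => n; exact: NV.
elim: N => [|N IH]; first by near=> n.
have sN : \forall n \near \oo, s n <> N.
  have [[m smN]|noN] := pselect (exists m, s m = N).
    by exists m.+1 => // n /= mn; rewrite -smN => /s_inj nm; rewrite nm ltnn in mn.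
  by near=> n => snN; apply: noN; exists n.
near=> n; rewrite ltn_neqAle; apply/andP; split; last by near: n.
by rewrite eq_sym; apply/eqP; near: n.
Unshelve. all: by end_near. Qed.

Lemma limn_esup_inj (R : realType) (u : nat -> \bar R) (s : nat -> nat) :
  injective s -> (limn_esup (u \o s) <= limn_esup u)%E.
Proof.
move=> s_inj; apply: le_ereal_inf_tmp => _ [V oV <-].
apply: ge_ereal_inf; exists (ereal_sup ((u \o s) @` (s @^-1` V))).
  by exists (s @^-1` V) => //; exact: inj_cvg_infty oV.
by apply: ereal_sup_le => _ [n Vn <-]; exists (s n).
Qed.

(** Reduces a bound for every enumeration of [S] to one explicit injective family; [g] may meet the
    terms of [e] in any order. *)
Lemma limsup_quality_inj (R : realType) (n : nat) (S : set {ffun 'I_n -> gint})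
    (e g : nat -> {ffun 'I_n -> gint}) :
  enumerates S e -> injective g -> (forall k, S (g k)) ->
  (forall k, ~ all_units n (g k)) ->
  (limsup_quality R g <= limsup_quality R e)%E.
Proof.
move=> [_ _ e_surj] g_inj gS gU.
have /choice[s es] k : exists i, e i = g k.
  by have [|i _ <-] := e_surj (g k); [split | exists i].
have s_inj : injective s by move=> i j sij; apply: g_inj; rewrite -!es sij.
rewrite /limsup_quality; under eq_fun do rewrite -es.
exact: (@limn_esup_inj _ (fun k => (quality R (e k))%:E)).
Qed.

(** * Norms, coprimality and radical of the quadruple *)

Lemma gaussnormX (z : gint) (k : nat) : gaussnorm (z ^+ k) = (gaussnorm z ^ k)%N.
Proof.
elim: k => [|k IH]; first by rewrite expr0.
by rewrite exprS gaussnormM IH expnS.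
Qed.

(** With [w = 4 * c - 1], the product of the conjugates is [w ^ 2 + w + 1] and their sum is
    [- (w + 1)]. This single relation makes each two of the three bases coprime. *)
Lemma quad_bezout (c b : int) : pell c b ->
  GInt (- (2 * c)) b * GInt (- (2 * c)) (- b) +
  (GInt (- (2 * c)) b + GInt (- (2 * c)) (- b)) * GInt (4 * c - 1) 0 = 1.
Proof.
rewrite /pell => cb; rewrite (_ : 1 = GInt 1 0)//; congr GInt => /=; last ring.
by rewrite (mulrN b) -[b * b]expr2 cb; ring.
Qed.

Lemma quad_condG2 (c b : int) : pell c b -> condG2 (quad c b).
Proof.
move=> /quad_bezout; set u := GInt _ b; set v := GInt _ (- b); set w := GInt _ 0.
move=> uvw.
have [r [s wu]] : bezout (w ^+ 5) (u ^+ 5).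
  by apply: bezoutX; exists (u + v), v; rewrite -[RHS]uvw; ring.
have [r' [s' wv]] : bezout (w ^+ 5) (v ^+ 5).
  by apply: bezoutX; exists (u + v), u; rewrite -[RHS]uvw; ring.
have [r'' [s'' uv]] : bezout (u ^+ 5) (v ^+ 5).
  by apply: bezoutX; exists (v + w), w; rewrite -[RHS]uvw; ring.
case=> -[|[|[|[|//]]]] ? [] -[|[|[|[|//]]]] ? //= _;
  rewrite !ffunE /= -/u -/v -/w.
- by apply: (@is_gcd1_bezout _ _ true false 1 0); rewrite mul1r mul0r addr0.
- by apply: (@is_gcd1_bezout _ _ true false 1 0); rewrite mul1r mul0r addr0.
- by apply: (@is_gcd1_bezout _ _ true false 1 0); rewrite mul1r mul0r addr0.
- exact: (@is_gcd1_bezout _ _ true false _ _ wu).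
- exact: (@is_gcd1_bezout _ _ true false _ _ wv).
- exact: (@is_gcd1_bezout _ _ true false _ _ uv).
Qed.

Lemma gaussnorm_linear (c : int) :
  gaussnorm (GInt (4 * c - 1) 0) = (`|(4 * c - 1)%R| ^ 2)%N.
Proof. by rewrite /gaussnorm /= addn0. Qed.

Lemma gaussnorm_quadratic (c b : int) : pell c b -> 1 <= c ->
  gaussnorm (GInt (- (2 * c)) b) = (`|(4 * c - 1)%R| ^ 2 + `|(4 * c - 1)%R| + 1)%N.
Proof.
rewrite /pell => cb c1; apply/eqP; rewrite -eqz_nat gaussnormE /= cb.
rewrite !PoszD -abszX !abszE !ger0_norm; [|lia|exact: sqr_ge0].
by apply/eqP; ring.
Qed.

Lemma quad_neq0 (c b : int) : pell c b -> 1 <= c -> forall j, quad c b j != 0.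
Proof.
move=> cb c1 j.
have neq0 (z : gint) : (0 < gaussnorm z)%N -> z ^+ 5 != 0.
  by move=> z0; apply: contraTneq z0 => z5;
     rewrite -(@ltn_exp2r _ _ 5)// -gaussnormX z5.
case: j => -[|[|[|[|//]]]] ?; rewrite ffunE //=; apply: neq0.
- by rewrite gaussnorm_linear expn_gt0; apply/orP; left; lia.
- by rewrite gaussnorm_quadratic// addn1.
- by rewrite gaussnorm_quadratic ?addn1// /pell sqrrN.
Qed.

Lemma quad_U (c b : int) : pell c b -> 1 <= c -> b != 0 -> U_set 4 (quad c b).
Proof.
move=> cb c1 b0; split; [exact: quad_neq0|exact: quad_condZ|exact: quad_condS2|].
exact: quad_condG2.
Qed.

Lemma quad_not_units (c b : int) : 1 <= c -> ~ all_units 4 (quad c b).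
Proof.
move=> c1 /(_ (lift ord0 ord0)); rewrite ffunE /= unfold_in /= => /eqP.
rewrite gaussnormX gaussnorm_linear -expnM => /eqP.
by rewrite -[X in _ == X](exp1n (2 * 5)) eqn_exp2r// => /eqP; lia.
Qed.

(** S2 forbids more coefficient vectors than S1, and a common divisor of all entries divides the
    first two, which are coprime. *)
Lemma U_set_sub_A_set (n : nat) : (1 < n)%N -> U_set n `<=` A_set n.
Proof.
move=> n1 a [a0 aZ aS aG]; split=> //.
  move=> [t [tB ij st]]; apply: aS; exists t; split=> // k.
  by rewrite inE tB orbT.
have [_ g01] := aG (Ordinal (ltnW n1)) (Ordinal n1) (ltnSn 0).
split=> [k|c ca]; first by exists (a k); rewrite mulr1.
by apply: g01 => -[].
Qed.

Lemma prod_quad (c b : int) : \prod_(j < 4) quad c b j =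
  (GInt (4 * c - 1) 0 * (GInt (- (2 * c)) b * GInt (- (2 * c)) (- b))) ^+ 5.
Proof. by rewrite !big_ord_recl big_ord0 !ffunE /= mulr1 mul1r -!exprMn. Qed.

Lemma radn_quad (c b : int) : pell c b -> 1 <= c ->
  let w := `|(4 * c - 1)%R|%N in
  (1 < radn (gaussnorm (\prod_(j < 4) quad c b j)%R) <= w ^ 3 + w ^ 2 + w)%N.
Proof.
move=> cb c1; set w := `|_|%N; rewrite /=; have w3 : (3 <= w)%N by rewrite /w; lia.
have cb' : pell c (- b) by rewrite /pell sqrrN.
rewrite prod_quad gaussnormX !gaussnormM gaussnorm_linear.
rewrite !gaussnorm_quadratic// -/w.
set n := (w ^ 2 + w + 1)%N.
(* The conjugates share the norm [n], which makes the norm of the product a tenth power. *)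
have -> : ((w ^ 2 * (n * n)) ^ 5 = (w * n) ^ 10)%N.
  by rewrite mulnn -expnMn -expnM.
have -> : (w ^ 3 + w ^ 2 + w = w * n)%N by rewrite /n; lia.
have wn : (1 < w * n)%N by rewrite /n; nia.
apply/andP; split; last by apply: radn_exp_le; lia.
by apply: radn_gt1; rewrite -(exp1n 10) ltn_exp2r.
Qed.

(** * Lower bound for the quality *)

Lemma quality_ratio_ge (R : realType) (w M r : nat) :
  (3 <= w)%N -> (w ^ 10 <= M)%N -> (1 < r <= w ^ 3 + w ^ 2 + w)%N ->
  10 / 3 - 2 * (ln w%:R)^-1 <= ln M%:R / ln r%:R :> R.
Proof.
move=> w3 wM /andP[r1 rw].
have w0 : 0 < w%:R :> R by rewrite ltr0n; lia.
have r0 : 0 < r%:R :> R by rewrite ltr0n; lia.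
have M0 : 0 < M%:R :> R by rewrite ltr0n (leq_trans _ wM)// expn_gt0; lia.
have l0 : 0 < ln w%:R :> R by rewrite ln_gt0// ltr1n; lia.
have lr0 : 0 < ln r%:R :> R by rewrite ln_gt0// ltr1n.
have lM : 10 * ln w%:R <= ln M%:R :> R.
  rewrite mulr_natl -lnXn// ler_ln ?posrE ?exprn_gt0//.
  by rewrite -natrX ler_nat.
have lr : ln r%:R <= 1 + 3 * ln w%:R :> R.
  (* For [w >= 3], [w ^ 2 + w <= w ^ 3]; writing 2 as [1 + 1] lets [le_ln1Dx] give [ln 2 <= 1]. *)
  have : ln r%:R <= ln ((1 + 1) * w%:R ^+ 3) :> R.
    rewrite ler_ln ?posrE ?mulr_gt0 ?exprn_gt0//.
    rewrite -(natrD _ 1 1) -natrX -natrM ler_nat (leq_trans rw)//.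
    by rewrite !expnS expn0; nia.
  rewrite lnM ?posrE ?exprn_gt0// lnXn// -[_ *+ 3]mulr_natl.
  by have := @le_ln1Dx R 1; lra.
set L := ln w%:R in l0 lM lr *; set rr := ln r%:R in lr0 lr *.
rewrite ler_pdivlMr//; apply: le_trans lM.
have LV : L * L^-1 = 1 by rewrite divff// gt_eqF.
have LV0 : 0 < L^-1 by rewrite invr_gt0.
(* Multiplying [lr] by the bound needs a nonnegative factor. Then [(10/3 - 2/L) (1 + 3 L) = 10 L -
   8/3 - 2/L], which is below [10 L]. *)
have [neg|pos] := leP (10 / 3 - 2 * L^-1) 0.
  by apply: le_trans (_ : 0 <= _); [nra|lra].
apply: le_trans (ler_wpM2l (ltW pos) lr) _.
move: L^-1 LV LV0 {pos} => V LV V0; nra.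
Qed.

Lemma le_limn_esup (R : realType) (u v : nat -> \bar R) :
  (forall n, (u n <= v n)%E) -> (limn_esup u <= limn_esup v)%E.
Proof.
move=> uv; apply: le_ereal_inf_tmp => _ [V oV <-].
apply: ge_ereal_inf; exists (ereal_sup (u @` V)); first by exists V.
apply: ge_ereal_sup => _ [n Vn <-]; apply: le_trans (uv n) _.
by apply: ereal_sup_ubound; exists n.
Qed.

Lemma quality_quad_ge (R : realType) (c b : int) : pell c b -> 1 <= c ->
  10 / 3 - 2 * (ln (`|(4 * c - 1)%R|%N)%:R)^-1 <= quality R (quad c b).
Proof.
move=> cb c1; apply: quality_ratio_ge; [lia| |exact: radn_quad].
(* The entry [(4 * c - 1) ^ 5] alone has norm [w ^ 10]. *)
apply: leq_trans (leq_bigmax (lift ord0 ord0)).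
by rewrite ffunE /= gaussnormX gaussnorm_linear -expnM.
Qed.

(* With X = 3 a - 1 the equation reads X ^ 2 - 3 b ^ 2 = - 2; the step multiplies
   X + b sqrt 3 by the unit 7 + 4 sqrt 3, which keeps a even. *)
Fixpoint pell_sol (k : nat) : int * int :=
  if k is k'.+1 then
    let: (c, b) := pell_sol k' in (7 * c + 2 * b - 1, 24 * c + 7 * b - 4)
  else (1, 3).

(** The bound [k < c] serves both for [1 <= c] and for the divergence of [ln w]. *)
Lemma pell_solP (k : nat) : let: (c, b) := pell_sol k in
  [/\ pell c b, k%:Z < c & 0 < b].
Proof.
elim: k => [|k] //=; case: (pell_sol k) => c b [cb kc b0].
by split; [move: cb; rewrite /pell !expr2|..]; lia.
Qed.

Definition quad_seq (k : nat) : {ffun 'I_4 -> gint} :=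
  quad (pell_sol k).1 (pell_sol k).2.

(** The second entry, an odd power, determines [c], which increases strictly along the recursion. *)
Lemma quad_seq_inj : injective quad_seq.
Proof.
have c_lt : {homo (fun k => (pell_sol k).1) : i j / (i < j)%N >-> i < j}.
  apply: homo_ltn => [|k]; first exact: lt_trans.
  by have /= := pell_solP k; case: (pell_sol k) => c b [_ + +] /=; lia.
move=> i j /ffunP /(_ (lift ord0 ord0)); rewrite !ffunE /= !gintX5.
rewrite !(mulr0, mul0r, expr0n, addr0, subr0) /= => -[/eqP].
have := pell_solP i; have := pell_solP j.
case Ei: (pell_sol i) => [ci bi]; case Ej: (pell_sol j) => [cj bj] /=.
move=> [_ cj0 _] [_ ci0 _]; rewrite eqrXn2//; [|lia|lia] => /eqP cij.
by case: (ltngtP i j) => // /c_lt; rewrite Ei Ej /=; lia.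
Qed.

Lemma quad_seq_U (k : nat) : U_set 4 (quad_seq k).
Proof.
rewrite /quad_seq; have := pell_solP k; case: (pell_sol k) => c b [cb kc b0].
by apply: quad_U => //=; lia.
Qed.

Lemma quad_seq_not_units (k : nat) : ~ all_units 4 (quad_seq k).
Proof.
rewrite /quad_seq; have := pell_solP k; case: (pell_sol k) => c b [_ kc _].
by apply: quad_not_units => /=; lia.
Qed.

Lemma infinite_U_set : infinite_set (U_set 4).
Proof.
move=> /(finite_preimage (f := quad_seq) (in2W quad_seq_inj)).
rewrite (_ : _ @^-1` _ = setT); first exact: infinite_nat.
by apply/seteqP; split=> // k _; exact: quad_seq_U.
Qed.

Lemma quad_seq_limsup (R : realType) :
  ((10 / 3)%:E <= limsup_quality R quad_seq)%E.
Proof.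
pose w k := `|(4 * (pell_sol k).1 - 1)%R|%N.
have kw k : (k < w k)%N.
  by rewrite /w; have := pell_solP k; case: (pell_sol k) => c b [_ + _] /=; lia.
have w_oo : (fun k => ln (w k)%:R : R) @ \oo --> +oo.
  apply/cvgryPge => A; near=> k.
  (* With [A] written as [ln (expR A)], it suffices that [k] exceeds [expR A]. *)
  rewrite -[A]expRK ler_ln ?posrE ?expR_gt0 ?ltr0n//; last exact: leq_trans (kw k).
  apply: (@le_trans _ _ k%:R); last by rewrite ler_nat ltnW.
  by near: k; exact: nbhs_infty_ger.
have v_cvg : (fun k => 10 / 3 - 2 * (ln (w k)%:R)^-1 : R) @ \oo --> (10 / 3 : R).
  rewrite -[X in _ --> X]subr0 -[X in _ - X](mulr0 2).
  apply: cvgB; first exact: cvg_cst.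
  apply: cvgM; first exact: cvg_cst.
  apply/gtr0_cvgV0; last exact: w_oo.
  near=> j; rewrite ln_gt0// ltr1n.
  by apply: leq_trans (kw j); rewrite ltnS; near: j; exact: nbhs_infty_gt.
have v_ecvg :
    (fun k => (10 / 3 - 2 * (ln (w k)%:R)^-1 : R)%:E) @ \oo --> (10 / 3)%:E.
  by apply: cvg_EFin; [near=> i|exact: v_cvg].
rewrite -(cvg_limn_einf_sup v_ecvg).2; apply: le_limn_esup => k.
rewrite lee_fin /w /quad_seq; have := pell_solP k.
by case: (pell_sol k) => c b [cb kc _] /=; apply: quality_quad_ge => //; lia.
Unshelve. all: by end_near. Qed.

Theorem theorem3p6 (R : realType) :
  infinite_set (A_set 4) /\ infinite_set (U_set 4) /\
  forall eA eU : nat -> {ffun 'I_4 -> gint},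
    enumerates (A_set 4) eA -> enumerates (U_set 4) eU ->
    (limsup_quality R eU <= limsup_quality R eA)%E /\
    ((10 / 3)%:E <= limsup_quality R eU)%E.
Proof.
have UA := @U_set_sub_A_set 4 isT.
split; first exact: sub_infinite_set UA infinite_U_set.
split; first exact: infinite_U_set.
move=> eA eU eAP eUP; split.
  (* An enumeration of U is itself an injective family in A. *)
  have [eU_fun eU_inj _] := eUP.
  have eU_U k : (U_set 4 `\` all_units 4) (eU k) by exact: eU_fun.
  apply: limsup_quality_inj eAP _ _ _ => [|k|k]; first exact: in2TT eU_inj.
    by apply: UA; have [] := eU_U k.
  by have [] := eU_U k.
apply: le_trans (quad_seq_limsup R) _.
exact: limsup_quality_inj eUP quad_seq_inj quad_seq_U quad_seq_not_units.
Qed.
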